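(* Let $A$ be a finite alphabet, and regard $A^{+}$ as an involution semigroup with word reversal $w\mapsto w^{r}$ as involution. A language $L\subseteq A^{+}$ is weakly locally-reversible threshold testable if and only if $L$ is recognised by a locally hermitian semidirect product $\mathcal{S}\ltimes\mathcal{T}$ of a finite involution semigroup $\mathcal{S}$ whose underlying semigroup is aperiodic and commutative and a finite involution semigroup $\mathcal{T}$ whose underlying semigroup is locally trivial.
   Context: For $t>0$ and $i,j\in\mathbb{N}$, write $i=^{t}j$ if either $i=j<t$, or $i\ge t$ and $j\ge t$. For $w,v\in A^{*}$, let $\sharp^{r}(w,v)$ be the number of pairs $(x,y)\in A^{*}\times A^{*}$ with $w=xvy$ or $w=xv^{r}y$. For $k,t>0$, two words $w,w'\in A^{*}$ are $\approx^{t}_{k}$-equivalent if either $|w|<k$ and $w=w'$, or both have length at least $k$ and they have the same prefix of length $k-1$, the same suffix of length $k-1$, and $\sharp^{r}(w,v)=^{t}\sharp^{r}(w',v)$ for every $v\in A^{+}$ of length at most $k$. A language is weakly locally-reversible threshold testable if it is a union of $\approx^{t}_{k}$-classes for some $k,t>0$. An involution semigroup $(S,\star)$ is a semigroup with a map $\star$ satisfying $(a^\star)^\star=a$ and $(ab)^\star=b^\star a^\star$. A semigroup is aperiodic if there is $n$ with $a^{n+1}=a^{n}$ for all $a$; locally trivial if $ese=e$ for every element $s$ and every idempotent $e$. A morphism of involution semigroups is a semigroup morphism commuting with the involutions. An involution semigroup $(S,\star)$ recognises $L\subseteq A^{+}$ if there is a morphism of involution semigroups $h:(A^{+},r)\to(S,\star)$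 and $P\subseteq S$ with $L=h^{-1}(P)$. Let $(S,\star)$, $(T,\diamond)$ be involution semigroups, with the operation of $S$ written additively (not assumed commutative). A left action of $T$ on $S$ is a map $(t,s)\mapsto ts$ with $t(s+s')=ts+ts'$ and $(tt')s=t(t's)$; a right action $(s,t)\mapsto st$ satisfies $(s+s')t=st+s't$ and $s(tt')=(st)t'$; they are compatible if $(ts)t'=t(st')$, and such a pair is a bilateral action. It is an involutory action if moreover $(st)^\star=t^\diamond s^\star$ for all $s\in S,t\in T$. It is locally hermitian if in addition $ese^\diamond=es^\star e^\diamond$ for every idempotent $e\in T$ and every $s\in S$. The semidirect product $\mathcal{S}\ltimes\mathcal{T}$ is the set $S\times T$ with product $(s_1,t_1)(s_2,t_2)=(s_1t_2+t_1s_2,\,t_1t_2)$ and involution $(s,t)\mapsto(s^\star,t^\diamond)$; it is called locally hermitian when the action is locally hermitian. *)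

(* Defs.v *)
(* Plain MathComp. *)
From HB Require Import structures.
From mathcomp Require Import all_boot.
Set Implicit Arguments.
Unset Strict Implicit.
Unset Printing Implicit Defensive.

Local Open Scope group_scope.

Definition thr_eq (t i j : nat) : bool :=
  ((i == j) && (i < t)) || ((t <= i) && (t <= j)).

Section Words.
Variable A : finType.
Implicit Types (w v x y : seq A) (L : seq A -> Prop).

Definition prefixes w := [seq take i w | i <- iota 0 (size w).+1].
Definition suffixes w := [seq drop i w | i <- iota 0 (size w).+1].

(* The pairs (x, y) with w = x v y or w = x v^r y; a pair satisfying both
   conditions is listed once. See mem_rev_occs and rev_occs_uniq. *)
Definition rev_occs w v : seq (seq A * seq A) :=
  [seq p <- [seq (x, y) | x <- prefixes w, y <- suffixes w]
     | (w == p.1 ++ v ++ p.2) || (w == p.1 ++ rev v ++ p.2)].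

Definition sharpr w v : nat := size (rev_occs w v).

Lemma mem_rev_occs w v x y :
  ((x, y) \in rev_occs w v) = (w == x ++ v ++ y) || (w == x ++ rev v ++ y).
Proof.
rewrite mem_filter; apply: andb_idr => w_occ.
have [u ->] : exists u, w = x ++ u ++ y.
  by case/orP: w_occ => /eqP->; [exists v | exists (rev v)].
apply/allpairsPdep; exists x, y; split=> //; apply/mapP.
- exists (size x); last by rewrite take_size_cat.
  by rewrite mem_iota /= ltnS size_cat leq_addr.
- exists (size (x ++ u)); last by rewrite catA drop_size_cat.
  by rewrite mem_iota /= ltnS !size_cat leq_add2l leq_addr.
Qed.

Lemma rev_occs_uniq w v : uniq (rev_occs w v).
Proof.
apply: filter_uniq; apply: allpairs_uniq; last by case=> ? ? [].
- rewrite map_inj_in_uniq ?iota_uniq // => i j.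
  rewrite !mem_iota /= !ltnS => le_i le_j /(congr1 size).
  by rewrite !size_takel.
- rewrite map_inj_in_uniq ?iota_uniq // => i j.
  rewrite !mem_iota /= !ltnS => le_i le_j /(congr1 size).
  rewrite !size_drop => eq_ij.
  by rewrite -(subKn le_i) eq_ij subKn.
Qed.

Definition thr_equiv (k t : nat) w w' : Prop :=
  (size w < k /\ w = w') \/
  [/\ k <= size w, k <= size w',
      take k.-1 w = take k.-1 w',
      drop (size w - k.-1) w = drop (size w' - k.-1) w'
    & forall v, 0 < size v <= k -> thr_eq t (sharpr w v) (sharpr w' v)].

(* C is a set of representatives of the classes whose union is L. *)
Definition weakly_lrtt L : Prop :=
  exists k t : nat,
    [/\ 0 < k, 0 < t
      & exists C : seq A -> Prop,
          forall w, L w <-> exists2 u, C u & thr_equiv k t u w].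

End Words.

HB.mixin Record Semigroup_isInvolSemigroup S of Semigroup S := {
  star : S -> S;
  starK : involutive star;
  starM : {morph star : x y / x * y >-> y * x}
}.

#[short(type="involSemigroupType")]
HB.structure Definition InvolSemigroup :=
  {S of Semigroup_isInvolSemigroup S & Semigroup S}.

#[short(type="finInvolSemigroupType")]
HB.structure Definition FinInvolSemigroup :=
  {S of InvolSemigroup S & Finite S}.

(* Nonempty words, with concatenation and reversal. *)
Definition plus (A : finType) := {w : seq A | w != [::]}.

Section Plus.
Variable A : finType.
Implicit Types u v w : plus A.

HB.instance Definition _ := Choice.on (plus A).

Lemma plus_mul_subproof u v : val u ++ val v != [::].
Proof. by case: u => -[]. Qed.
Definition plus_mul u v : plus A := Sub (val u ++ val v) (plus_mul_subproof u v).

Lemma plus_rev_subproof u : rev (val u) != [::].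
Proof. by rewrite -size_eq0 size_rev size_eq0; apply: (valP u). Qed.
Definition plus_rev u : plus A := Sub (rev (val u)) (plus_rev_subproof u).

Lemma plus_mulA : associative plus_mul.
Proof. by move=> u v w; apply: val_inj; rewrite /= catA. Qed.
HB.instance Definition _ := isSemigroup.Build (plus A) plus_mulA.

Lemma plus_revK : involutive plus_rev.
Proof. by move=> u; apply: val_inj; rewrite /= revK. Qed.
Lemma plus_revM : {morph plus_rev : u v / u * v >-> v * u}.
Proof. by move=> u v; apply: val_inj; rewrite /= rev_cat. Qed.
HB.instance Definition _ :=
  Semigroup_isInvolSemigroup.Build (plus A) plus_revK plus_revM.

End Plus.

Definition is_idempotent (S : semigroupType) (e : S) : Prop := e * e = e.

(* Semigroups have no unit, so a^n is meaningful only for n > 0. *)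
Definition aperiodic (S : semigroupType) : Prop :=
  exists2 n : nat, 0 < n &
    forall a : S, iterop n.+1 *%g a a = iterop n *%g a a.

Definition locally_trivial (S : semigroupType) : Prop :=
  forall s e : S, is_idempotent e -> e * s * e = e.

Record involutory_action (S T : involSemigroupType) := InvolutoryAction {
  lact : T -> S -> S;
  ract : S -> T -> S;
  lactD : forall t, {morph lact t : s s' / s * s'};
  lactM : forall t t' s, lact (t * t') s = lact t (lact t' s);
  ractD : forall t, {morph ract^~ t : s s' / s * s'};
  ractM : forall s t t', ract s (t * t') = ract (ract s t) t';
  lractC : forall t s t', ract (lact t s) t' = lact t (ract s t');
  ract_star : forall s t, star (ract s t) = lact (star t) (star s)
}.

Definition locally_hermitian (S T : involSemigroupType)
    (act : involutory_action S T) : Prop :=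
  forall (e : T) (s : S), is_idempotent e ->
    ract act (lact act e s) (star e) = ract act (lact act e (star s)) (star e).

(* An alias of S * T, because S * T itself carries the direct product. *)
Definition sdprod (S T : involSemigroupType) (act : involutory_action S T) :
  Type := (S * T)%type.

Section Sdprod.
Variables (S T : involSemigroupType) (act : involutory_action S T).
Local Notation ST := (sdprod act).
Implicit Types p q : ST.

HB.instance Definition _ := Choice.copy ST (S * T)%type.

Definition sdprod_mul p q : ST :=
  (ract act p.1 q.2 * lact act p.2 q.1, p.2 * q.2).
Definition sdprod_star p : ST := (star p.1, star p.2).

Lemma sdprod_mulA : associative sdprod_mul.
Proof.
move=> [s1 t1] [s2 t2] [s3 t3]; rewrite /sdprod_mul /= mulgA.
by rewrite lactD ractD lactM ractM lractC mulgA.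
Qed.
HB.instance Definition _ := isSemigroup.Build ST sdprod_mulA.

Lemma lact_star t s : star (lact act t s) = ract act (star s) (star t).
Proof. by rewrite -[RHS]starK ract_star !starK. Qed.

Lemma sdprod_starK : involutive sdprod_star.
Proof. by case=> s t; rewrite /sdprod_star /= !starK. Qed.
Lemma sdprod_starM : {morph sdprod_star : p q / p * q >-> q * p}.
Proof.
move=> [s t] [s' t'].
by congr pair; rewrite /= starM // ract_star lact_star.
Qed.
HB.instance Definition _ :=
  Semigroup_isInvolSemigroup.Build ST sdprod_starK sdprod_starM.

End Sdprod.

Definition recognises (A : finType) (S : involSemigroupType)
    (L : seq A -> Prop) : Prop :=
  exists (h : {multiplicative plus A -> S}) (P : S -> Prop),
    {morph h : u / star u} /\
    forall w : seq A, L w <-> exists2 u : plus A, val u = w & P (h u).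

(* Main.v *)
(* Recognition by a locally hermitian product gives threshold conditions: the
   first component of the image of a word is the sum, over its letters a, of
   t_x s_a t_y, where x and y are the words to the left and to the right of a.
   In a finite locally trivial semigroup the value of a long word is idempotent,
   and depends only on a prefix and a suffix.  So, except near the two ends, the
   summand of a depends only on the ends of the word and on a window of fixed
   length centred at a; local hermiticity makes it invariant under reversal of
   that window, and aperiodicity makes the sum depend only on the number of
   windows of each kind up to a threshold.

   Conversely, let T consist of the pairs (prefix, suffix) of length at most k,
   and S of the multisets, with multiplicities cut at 2t, of letters with left
   and right contexts of length at most k; T acts by extending contexts.
   Identifying a context with its mirror image when it is of length k on both
   sides makes the action locally hermitian.  The number of occurrences of v or
   v^r starting at a given letter is not invariant under reversal, but the number
   of those starting or ending there is; summed over all letters, it gives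
   2 sharpr w v, which is therefore known up to the threshold 2t. *)
Require Import Defs.
From HB Require Import structures.
From mathcomp Require Import all_boot.
From mathcomp Require Import zify.
Set Implicit Arguments.
Unset Strict Implicit.
Unset Printing Implicit Defensive.

(** * Contexts of letters in a word *)

Section Contexts.
Variable A : finType.
Implicit Types (w u v x y : seq A) (a : A).

Local Notation context := (seq A * A * seq A)%type.
Implicit Types c : context.

(* In a context (x, a, y), the left part x is read backwards from a, so that
   reversal of words becomes the swap of x and y. *)
Fixpoint contexts x w y : seq context :=
  if w is a :: w' then (x, a, w' ++ y) :: contexts (a :: x) w' y else [::].

Lemma contexts_cat x u v y :
  contexts x (u ++ v) y = contexts x u (v ++ y) ++ contexts (rev u ++ x) v y.
Proof. by elim: u x => //= a u IH x; rewrite IH catA rev_cons cat_rcons. Qed.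

Lemma contexts_extend x' w y' x y :
  contexts (x' ++ x) w (y' ++ y) =
  [seq (c.1.1 ++ x, c.1.2, c.2 ++ y) | c <- contexts x' w y'].
Proof.
by elim: w x' => //= a w IH x'; rewrite -IH catA.
Qed.

Lemma contextsE x w y :
  contexts x w y =
  [seq (c.1.1 ++ x, c.1.2, c.2 ++ y) | c <- contexts [::] w [::]].
Proof. by rewrite -(contexts_extend [::] w [::]). Qed.

Lemma mem_contexts w x a y :
  ((x, a, y) \in contexts [::] w [::]) = (w == rev x ++ a :: y).
Proof.
(* The induction runs over an accumulated left part [l]; the size condition leaves out the letters
   of [l] itself. *)
suff H l : ((x, a, y) \in contexts l w [::]) =
           (size l <= size x) && (rev l ++ w == rev x ++ a :: y).
  by rewrite H.
elim: w l => [|b w IH] l /=.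
  rewrite in_nil cats0; apply/esym/andP => -[le_lx /eqP/(congr1 size)].
  by rewrite size_cat !size_rev /=; lia.
rewrite in_cons {}IH cats0 rev_cons cat_rcons /=.
have [lt_xl|lt_lx|eq_lx] := ltngtP (size x) (size l) => /=.
- by rewrite orbF; apply/eqP => -[eq_xl _ _]; rewrite eq_xl ltnn in lt_xl.
- apply: orb_idl => /eqP[eq_xl]; by rewrite eq_xl ltnn in lt_lx.
rewrite orbF eqseq_cat ?size_rev // (inj_eq (can_inj revK)) eqseq_cons.
by rewrite -pair_eqE /= -pair_eqE /= andbA ![_ == x]eq_sym; congr (_ && _ && _);
  rewrite eq_sym.
Qed.

(** The left parts have consecutive, hence distinct, lengths. *)
Lemma contexts_uniq x w y : uniq (contexts x w y).
Proof.
apply: (@map_uniq _ _ (fun c => size c.1.1)).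
suff -> : map (fun c => size c.1.1) (contexts x w y) =
          iota (size x) (size w) by apply: iota_uniq.
by elim: w x => //= a w IH x; rewrite IH.
Qed.

(* The factor of length [l] whose letter of index [j] is the centre of [c],
   cut short if [c] does not extend that far. *)
Definition window j l c := rev (take j c.1.1) ++ take (l - j) (c.1.2 :: c.2).

Definition reads j v c :=
  (window j (size v) c == v) || (window j (size v) c == rev v).

Lemma reads_size j v c : j < size v -> reads j v c ->
  (j <= size c.1.1) && (size v - j <= (size c.2).+1).
Proof.
move=> lt_jv /orP[] /eqP/(congr1 size);
  rewrite /window ?size_rev size_cat size_rev !size_take_min /= => H;
  lia.
Qed.

(** Each occurrence is charged to its letter of index [j]. A palindrome [v] counts once on both
    sides, since [reads] is a disjunction. *)
Lemma sharprE j w v : j < size v ->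
  sharpr w v = count (reads j v) (contexts [::] w [::]).
Proof.
move=> lt_jv; set cs := contexts _ _ _.
pose g c := (rev (drop j c.1.1), drop (size v - j) (c.1.2 :: c.2)).
rewrite -size_filter -(size_map g); apply/perm_size/uniq_perm.
- exact: rev_occs_uniq.
- rewrite map_inj_in_uniq ?filter_uniq ?contexts_uniq //.
  move=> [[x a] y] [[x' a'] y']; rewrite !mem_filter /cs !mem_contexts.
  case/andP=> /(reads_size lt_jv)/andP[/= le_jx _] /eqP-> /andP[].
  move=> /(reads_size lt_jv)/andP[/= le_jx' _] eq_w [eq_x _].
  move/(congr1 size): eq_x; rewrite !size_rev !size_drop => eq_x.
  have {}eq_x : size x = size x' by rewrite -(subnK le_jx) eq_x subnK.
  move: eq_w; rewrite eqseq_cat ?size_rev // (inj_eq (can_inj revK)) eqseq_cons.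
  by case/and3P=> /eqP-> /eqP-> /eqP->.
move=> [X Y]; rewrite mem_rev_occs; apply/idP/mapP; last first.
  case=> -[[x a] y]; rewrite mem_filter mem_contexts => /andP[rd /eqP->] [-> ->].
  have -> : rev x ++ a :: y = rev (drop j x) ++ window j (size v) (x, a, y)
                              ++ drop (size v - j) (a :: y).
    by rewrite /window -catA cat_take_drop catA -rev_cat cat_take_drop.
  by case/orP: rd => /eqP->; rewrite eqxx ?orbT.
move=> occ.
have [u [eq_u sz_u eq_w]] :
    exists u, [/\ (u == v) || (u == rev v), size u = size v & w = X ++ u ++ Y].
  case/orP: occ => /eqP eq_w; first by exists v; rewrite eqxx.
  by exists (rev v); rewrite eqxx orbT size_rev.
have def_u : u = take j u ++ drop j u by rewrite cat_take_drop.
have sz_t : size (take j u) = j by rewrite size_takel // sz_u ltnW.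
have sz_d : size (drop j u) = size v - j by rewrite size_drop sz_u.
case def_d: (drop j u) sz_d => [|a d] sz_d; first by move: sz_d => /=; lia.
exists (rev (X ++ take j u), a, d ++ Y).
  rewrite mem_filter mem_contexts revK eq_w {2}def_u def_d -!catA eqxx andbT.
  rewrite /reads /window /= rev_cat take_size_cat ?size_rev // revK.
  by rewrite -sz_d /= take_size_cat // -def_d -def_u.
by rewrite /g /= rev_cat drop_size_cat ?size_rev // revK -sz_d /= drop_size_cat.
Qed.

Lemma thr_eq_refl t n : thr_eq t n n.
Proof. rewrite /thr_eq; lia. Qed.

Lemma thr_equiv_refl k t w : thr_equiv k t w w.
Proof.
have [lt_wk|le_kw] := ltnP (size w) k; [by left | right].
by split=> // v _; apply: thr_eq_refl.
Qed.

Lemma thr_equiv_trans k t u v w :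
  thr_equiv k t u v -> thr_equiv k t v w -> thr_equiv k t u w.
Proof.
case=> [[lt_uk ->]//|[ku kv p s n]] [[lt_vk <-]|[_ kw p' s' n']].
  by right.
right; split=> //; [by rewrite p | by rewrite s|].
by move=> z sz_z; move: (n z sz_z) (n' z sz_z); rewrite /thr_eq; lia.
Qed.

End Contexts.

(** * The semidirect product recognising a threshold language *)

(** Equal truncations mean equal numbers or numbers both at least [n]; a nonzero factor [g]
    preserves either case. *)
Lemma minn_mul n a b g :
  minn n a = minn n b -> minn n (a * g) = minn n (b * g).
Proof.
move=> eq_ab; have [->//|[le_na le_nb]] : a = b \/ n <= a /\ n <= b by lia.
case: g => [|g]; first by rewrite !muln0.
by rewrite !(minn_idPl _) // (leq_trans _ (leq_pmulr _ _)).
Qed.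

(** * Multisets with bounded multiplicities *)

Section Counters.
Variables (C : finType) (n : nat).

(* Multisets over [C] with multiplicities cut at [n]. *)
Local Notation counter := {ffun C -> 'I_n.+1}.
Implicit Types (l : seq C) (s : counter) (f : C -> C).

Definition mset l : counter := [ffun c => inord (minn n (count_mem c l))].

(** A list representative of [s]: operations on counters are done on lists and truncated again. *)
Definition elements s : seq C := flatten [seq nseq (s c) c | c <- enum C].

Definition push f s : counter := mset (map f (elements s)).

Definition add s s' : counter := mset (elements s ++ elements s').

Lemma msetE l c : mset l c = minn n (count_mem c l) :> nat.
Proof. by rewrite ffunE inordK // ltnS geq_minl. Qed.

Lemma mset_eqP l l' :
  mset l = mset l' <->
  forall c, minn n (count_mem c l) = minn n (count_mem c l').
Proof.
split=> [eq_l c|eq_l]; first by rewrite -!msetE eq_l.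
by apply/ffunP=> c; apply: val_inj; rewrite /= !msetE.
Qed.

Lemma count_elements s c : count_mem c (elements s) = s c.
Proof.
rewrite count_flatten -map_comp sumnE big_map big_enum (bigD1 c) //=.
rewrite count_nseq /= eqxx mul1n big1 ?addn0 // => d /negPf ne_dc.
by rewrite count_nseq /= ne_dc.
Qed.

Lemma elementsK s : mset (elements s) = s.
Proof.
apply/ffunP=> c; apply: val_inj.
by rewrite /= msetE count_elements; apply/minn_idPr; rewrite -ltnS.
Qed.

Lemma sum_count (G : C -> nat) l :
  \sum_(c <- l) G c = \sum_c count_mem c l * G c.
Proof.
elim: l => [|d l IH]; first by rewrite big_nil big1.
rewrite big_cons IH (bigD1 d) //= [RHS](bigD1 d) //= eqxx mulnDl mul1n addnA.
congr (_ + _); apply: eq_bigr => c ne_cd.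
by rewrite [d == c]eq_sym (negPf ne_cd).
Qed.

(** Truncation at [n] is compatible with addition and with multiplication by a weight. *)
Lemma mset_sum (G : C -> nat) l l' : mset l = mset l' ->
  minn n (\sum_(c <- l) G c) = minn n (\sum_(c <- l') G c).
Proof.
move/mset_eqP=> eq_l; rewrite (sum_count G l) (sum_count G l').
apply: (big_ind2 (fun a b => minn n a = minn n b)) => [//||c _].
  move=> a b a' b'; lia.
exact: minn_mul.
Qed.

Lemma mset_map f l l' : mset l = mset l' -> mset (map f l) = mset (map f l').
Proof.
move=> eq_l; apply/mset_eqP=> d.
have countE l0 : count_mem d (map f l0) = \sum_(c <- l0) (f c == d).
  by rewrite count_map -sum1_count big_mkcond.
by rewrite !countE; apply: mset_sum.
Qed.

Lemma mset_cat l1 l2 l1' l2' : mset l1 = mset l1' -> mset l2 = mset l2' ->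
  mset (l1 ++ l2) = mset (l1' ++ l2').
Proof.
move=> /mset_eqP eq1 /mset_eqP eq2; apply/mset_eqP=> c.
by move: (eq1 c) (eq2 c); rewrite !count_cat; lia.
Qed.

Lemma push_mset f l : push f (mset l) = mset (map f l).
Proof. by apply: mset_map; rewrite elementsK. Qed.

Lemma add_mset l l' : add (mset l) (mset l') = mset (l ++ l').
Proof. by apply: mset_cat; rewrite elementsK. Qed.

Lemma push_comp f g s : push f (push g s) = push (f \o g) s.
Proof. by rewrite -(elementsK s) !push_mset map_comp. Qed.

Lemma push_id f s : f =1 id -> push f s = s.
Proof. by move=> fE; rewrite -{1}(elementsK s) push_mset map_id_in ?elementsK. Qed.

Lemma eq_push f g s : f =1 g -> push f s = push g s.
Proof. by move=> eq_fg; rewrite /push (eq_map eq_fg). Qed.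

Lemma push_add f : {morph push f : s s' / add s s'}.
Proof.
move=> s s'; rewrite -(elementsK s) -(elementsK s').
by rewrite !(add_mset, push_mset) map_cat.
Qed.

Lemma addC : commutative add.
Proof.
move=> s s'; apply/mset_eqP=> c; by rewrite !count_cat addnC.
Qed.

Lemma addA : associative add.
Proof.
move=> s1 s2 s3; rewrite -(elementsK s1) -(elementsK s2) -(elementsK s3).
by rewrite !add_mset catA.
Qed.

Lemma iter_add m s : iter m (add s) s = mset (flatten (nseq m.+1 (elements s))).
Proof.
elim: m => [|m IH]; first by rewrite /= cats0 elementsK.
by rewrite iterS IH -{1}(elementsK s) add_mset.
Qed.

(** After [n.+1] copies each multiplicity is [0] or at least [n], so one more copy changes
    nothing. *)
Lemma iter_add_stable s : iter n.+1 (add s) s = iter n (add s) s.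
Proof.
rewrite !iter_add; apply/mset_eqP=> c.
rewrite !count_flatten !map_nseq !sumn_nseq.
case: (count_mem c _) => // b.
by rewrite !(minn_idPl _) // mulSn; lia.
Qed.

End Counters.

Section Counter.
Variables (C : finType) (n : nat) (sigma : C -> C).
Hypothesis sigmaK : involutive sigma.

(** The proof argument makes [sigma] part of the type, so that the star, [push sigma], can be
    attached to it. *)
Definition counter of involutive sigma : Type := {ffun C -> 'I_n.+1}.
Local Notation S := (counter sigmaK).

HB.instance Definition _ := Finite.on S.
HB.instance Definition _ := isSemigroup.Build S (@addA C n).

Lemma push_sigmaK : involutive (@push C n sigma).
Proof. by move=> s; rewrite push_comp push_id. Qed.

Lemma push_sigmaM : {morph @push C n sigma : s s' / add s s' >-> add s' s}.
Proof. by move=> s s'; rewrite push_add addC. Qed.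

HB.instance Definition _ :=
  Semigroup_isInvolSemigroup.Build S push_sigmaK push_sigmaM.

Lemma counter_aperiodic : aperiodic S.
Proof. by exists n.+1 => // s; rewrite !iteropS; apply: iter_add_stable. Qed.

End Counter.

(** * Truncated prefixes and suffixes *)

Section Ends.
Variables (A : finType) (k : nat).
Implicit Types (w x y : seq A) (p q : k.-bseq A).

Lemma size_take_bseq w : size (take k w) <= k.
Proof. by rewrite size_take_min geq_minl. Qed.

Definition trunc w : k.-bseq A := Bseq (size_take_bseq w).

(** Letters past the first [k] never come back into view; with [trunc_catr] this makes the product
    of [ends] associative. *)
Lemma trunc_catl x y : trunc (trunc x ++ y) = trunc (x ++ y).
Proof.
apply: val_inj; rewrite /= !take_cat size_take_min ltnNge geq_minl /=.
case: ltnP => [lt_kx|le_xk]; last by rewrite take_oversize.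
by rewrite subnn take0 cats0.
Qed.

Lemma trunc_catr x y : trunc (x ++ trunc y) = trunc (x ++ y).
Proof.
apply: val_inj; rewrite /= !take_cat; case: ifP => // _.
by rewrite -take_min (minn_idPl (leq_subr _ _)).
Qed.

Lemma trunc_full p y : size p = k -> trunc (p ++ y) = p.
Proof. by move=> sz_p; apply: val_inj; rewrite /= take_size_cat. Qed.

Lemma size_trunc w : size (trunc w) = minn k (size w).
Proof. by rewrite size_take_min. Qed.

(* A pair (prefix, reversed suffix), so that the involution is the swap. *)
Definition ends : Type :=
  {t : k.-bseq A * k.-bseq A | (0 < size t.1) && (0 < size t.2)}.
Implicit Types t : ends.

HB.instance Definition _ := Finite.on ends.

Lemma ends_mul_subproof t t' :
  (0 < size (trunc ((val t).1 ++ (val t').1))) &&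
  (0 < size (trunc ((val t').2 ++ (val t).2))).
Proof.
rewrite !size_trunc !size_cat.
move: (valP t) (valP t') (size_bseq (val t).1) => /=; lia.
Qed.
Definition ends_mul t t' : ends := 
  Sub (trunc ((val t).1 ++ (val t').1), trunc ((val t').2 ++ (val t).2))
      (ends_mul_subproof t t').

Lemma ends_star_subproof t : (0 < size (val t).2) && (0 < size (val t).1).
Proof. by rewrite andbC; apply: (valP t). Qed.
Definition ends_star t : ends := Sub ((val t).2, (val t).1) (ends_star_subproof t).

Lemma ends_mulA : associative ends_mul.
Proof.
move=> t1 t2 t3; apply: val_inj => /=.
by congr pair; rewrite trunc_catl trunc_catr catA.
Qed.
HB.instance Definition _ := isSemigroup.Build ends ends_mulA.

Lemma ends_starK : involutive ends_star.
Proof. by move=> t; apply: val_inj => /=; case: (val t). Qed.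
Lemma ends_starM : {morph ends_star : t t' / ends_mul t t' >-> ends_mul t' t}.
Proof. by move=> t t'; apply: val_inj. Qed.
HB.instance Definition _ :=
  Semigroup_isInvolSemigroup.Build ends ends_starK ends_starM.

(** Doubling a nonempty word of length below [k] lengthens it. As both parts of an element of [ends]
    are nonempty, those of an idempotent are full and absorb any extension. *)
Lemma trunc_idem p : 0 < size p -> trunc (p ++ p) = p -> size p = k.
Proof.
move=> p_gt0 /(congr1 (fun q => size q)).
by rewrite size_trunc size_cat; move: (size_bseq p); lia.
Qed.

Lemma ends_idem t : is_idempotent t -> size (val t).1 = k /\ size (val t).2 = k.
Proof.
case/andP: (valP t) => p_gt0 q_gt0 /(congr1 val) tt.
split; apply: trunc_idem => //.
  exact: (congr1 fst tt).
exact: (congr1 snd tt).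
Qed.

Lemma ends_locally_trivial : locally_trivial ends.
Proof.
move=> s t /ends_idem[sz1 sz2]; apply: val_inj => /=.
by rewrite trunc_catl -catA !trunc_full //; case: (val t).
Qed.

End Ends.

Definition flip {X Y : Type} (c : X * Y * X) : X * Y * X := (c.2, c.1.2, c.1.1).

Lemma flipK (X Y : Type) : involutive (@flip X Y).
Proof. by case=> -[]. Qed.

(** * Representatives up to mirror image *)

Section Canon.
Variables (X Y : countType).
Implicit Types c d : (X * Y * X)%type.

Definition canon c := if pickle c <= pickle (flip c) then c else flip c.

Lemma canonP c : canon c = c \/ canon c = flip c.
Proof. by rewrite /canon; case: ifP; [left | right]. Qed.

Lemma canon_flip c : canon (flip c) = canon c.
Proof.
rewrite /canon flipK; by case: ltngtP => // /(pcan_inj pickleK).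
Qed.

Lemma canon_idem c : canon (canon c) = canon c.
Proof. by case: (canonP c) => cE; rewrite {1}cE ?canon_flip. Qed.

Lemma eq_canon c d : (canon c == canon d) = (c == d) || (c == flip d).
Proof.
apply/eqP/orP => [eq_cd|[/eqP->//|/eqP->]]; last exact: canon_flip.
have [cE|cE] := canonP c; have [dE|dE] := canonP d; move: eq_cd; rewrite cE dE.
- by move->; left.
- by move->; right.
- by move=> <-; right; rewrite flipK.
- by move/(can_inj (@flipK _ _))->; left.
Qed.

End Canon.

(** * The action on contexts, and the profile of a word *)

Section Profiles.
Variables (A : finType) (k n : nat).
Local Notation context := (seq A * A * seq A)%type.
Local Notation bcontext := (k.-bseq A * A * k.-bseq A)%type.
Implicit Types (w v : seq A) (c : bcontext) (t : ends A k).

Definition full c := (size c.1.1 == k) && (size c.2 == k).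

(* Full contexts are fixed by both actions, which is what makes it consistent
   to identify them, and only them, with their mirror images. *)
Definition norm c := if full c then canon c else c.

(** Word reversal as seen on normal forms: a full context also represents its mirror image, so it
    stays. *)
Definition mirror c := if full c then c else flip c.

(** Contexts grow outwards: the left part is continued by the suffix in [t], which is stored
    reversed just as the left part is. *)
Definition extl t c : bcontext := (trunc k (c.1.1 ++ (val t).2), c.1.2, c.2).
Definition extr c t : bcontext := (c.1.1, c.1.2, trunc k (c.2 ++ (val t).1)).

Lemma full_flip c : full (flip c) = full c.
Proof. exact: andbC. Qed.

Lemma full_canon c : full (canon c) = full c.
Proof. by case: (canonP c) => ->; rewrite ?full_flip. Qed.

Lemma full_norm c : full (norm c) = full c.
Proof. by rewrite /norm; case: ifP => // fc; rewrite full_canon. Qed.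

Lemma mirrorK : involutive mirror.
Proof.
move=> c; rewrite {2}/mirror; case: ifP => fc; first by rewrite /mirror fc.
by rewrite /mirror full_flip fc flipK.
Qed.

Lemma norm_flip c : norm (flip c) = mirror (norm c).
Proof.
rewrite /mirror full_norm /norm full_flip.
by case: ifP => // _; apply: canon_flip.
Qed.

Lemma extl_full t c : full c -> extl t c = c.
Proof.
by case/andP=> /eqP sz _; rewrite /extl trunc_full //; case: c {sz} => -[].
Qed.

Lemma extr_full t c : full c -> extr c t = c.
Proof.
by case/andP=> _ /eqP sz; rewrite /extr trunc_full //; case: c {sz} => -[].
Qed.

Lemma norm_norm c : norm (norm c) = norm c.
Proof.
rewrite {1}/norm full_norm; case: ifP => // fc; rewrite /norm fc.
exact: canon_idem.
Qed.

(** Normalisation only alters full contexts, and these no longer grow. *)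
Lemma norm_extl t c : norm (extl t (norm c)) = norm (extl t c).
Proof.
have [fc|fc] := boolP (full c); last by rewrite {2}/norm (negPf fc).
by rewrite !extl_full ?full_norm // norm_norm.
Qed.

Lemma norm_extr t c : norm (extr (norm c) t) = norm (extr c t).
Proof.
have [fc|fc] := boolP (full c); last by rewrite {2}/norm (negPf fc).
by rewrite !extr_full ?full_norm // norm_norm.
Qed.

Lemma mirror_extr t c :
  mirror (norm (extr c t)) = norm (extl (star t) (mirror c)).
Proof.
rewrite -norm_flip [in RHS]/mirror; case: ifP => fc //.
by rewrite extr_full // extl_full // norm_flip /mirror full_norm fc.
Qed.

Local Notation S := (counter n mirrorK).
Local Notation T := (ends A k).

Definition ends_lact (t : T) (s : S) : S := push (norm \o extl t) s.
Definition ends_ract (s : S) (t : T) : S := push (norm \o extr^~ t) s.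

Lemma ends_lactD t : {morph ends_lact t : s s' / (s * s')%g}.
Proof. exact: push_add. Qed.

Lemma ends_ractD t : {morph ends_ract^~ t : s s' / (s * s')%g}.
Proof. exact: push_add. Qed.

Lemma ends_lactM t t' s : ends_lact (t * t')%g s = ends_lact t (ends_lact t' s).
Proof.
rewrite /ends_lact push_comp; apply: eq_push => c /=.
rewrite norm_extl /extl; congr (norm (_, _, _)).
by rewrite /= trunc_catl trunc_catr catA.
Qed.

Lemma ends_ractM s t t' : ends_ract s (t * t')%g = ends_ract (ends_ract s t) t'.
Proof.
rewrite /ends_ract push_comp; apply: eq_push => c /=.
rewrite norm_extr /extr; congr (norm (_, _, _)).
by rewrite /= trunc_catl trunc_catr catA.
Qed.

Lemma ends_lractC t s t' :
  ends_ract (ends_lact t s) t' = ends_lact t (ends_ract s t').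
Proof.
rewrite /ends_ract /ends_lact !push_comp; apply: eq_push => c /=.
by rewrite norm_extr norm_extl.
Qed.

Lemma ends_ract_star s t :
  star (ends_ract s t) = ends_lact (star t) (star s).
Proof.
rewrite /star /= /ends_ract /ends_lact !push_comp; apply: eq_push => c /=.
exact: mirror_extr.
Qed.

Definition ends_action : involutory_action S T :=
  InvolutoryAction ends_lactD ends_lactM ends_ractD ends_ractM
                   ends_lractC ends_ract_star.

(** An idempotent [t] has parts of length [k], so [c] surrounded by [t] and [star t] becomes full.
    Both sides are extended by the same word, hence [flip c] yields the mirror image, with the same
    normal form. *)
Lemma ends_action_hermitian : locally_hermitian ends_action.
Proof.
move=> t s /ends_idem[sz1 sz2].
rewrite /= /ends_ract /ends_lact /star /= !push_comp; apply: eq_push => c /=.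
rewrite !norm_extr /mirror; case: ifP => // _.
have f_ext : full (extr (extl t c) (ends_star t)).
  rewrite /full !size_trunc !size_cat /= sz2.
  by rewrite !(minn_idPl (leq_addl _ _)) eqxx.
have -> : extr (extl t (flip c)) (ends_star t) =
          flip (extr (extl t c) (ends_star t)) by [].
by rewrite norm_flip /mirror full_norm f_ext.
Qed.

Definition norm_context (c : context) : bcontext :=
  norm (trunc k c.1.1, c.1.2, trunc k c.2).

Definition profile (l : seq context) : S := mset n (map norm_context l).

Lemma profile_perm l l' : perm_eq l l' -> profile l = profile l'.
Proof.
move/(perm_map norm_context)/permP=> eq_l.
by apply/mset_eqP=> c; rewrite eq_l.
Qed.

Hypothesis k_gt0 : 0 < k.

Lemma word_ends_subproof (u : plus A) :
  (0 < size (trunc k (val u))) && (0 < size (trunc k (rev (val u)))).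
Proof.
rewrite !size_trunc size_rev leq_min k_gt0 lt0n size_eq0.
by rewrite (valP u).
Qed.

Definition word_ends (u : plus A) : T :=
  Sub (trunc k (val u), trunc k (rev (val u))) (word_ends_subproof u).

Lemma word_endsM : {morph word_ends : u v / (u * v)%g}.
Proof.
move=> u v; apply: val_inj; rewrite /= rev_cat.
by congr pair; rewrite trunc_catl trunc_catr.
Qed.

Lemma word_ends_star : {morph word_ends : u / star u}.
Proof. by move=> u; apply: val_inj; rewrite /= revK. Qed.

Lemma extl_profile u w :
  ends_lact (word_ends u) (profile (contexts [::] w [::])) =
  profile (contexts (rev (val u)) w [::]).
Proof.
rewrite /ends_lact [in LHS]/profile push_mset (contextsE (rev _)).
rewrite /profile -!map_comp.
congr mset; apply: eq_map => -[[x a] y] /=.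
by rewrite /norm_context norm_extl /extl /= trunc_catl trunc_catr cats0.
Qed.

Lemma extr_profile u w :
  ends_ract (profile (contexts [::] w [::])) (word_ends u) =
  profile (contexts [::] w (val u)).
Proof.
rewrite /ends_ract [in LHS]/profile push_mset.
rewrite (contextsE _ _ (val u)) /profile -!map_comp.
congr mset; apply: eq_map => -[[x a] y] /=.
by rewrite /norm_context norm_extr /extr /= trunc_catl trunc_catr cats0.
Qed.

Definition word_profile (u : plus A) : sdprod ends_action :=
  (profile (contexts [::] (val u) [::]), word_ends u).

Lemma word_profileM : {morph word_profile : u v / (u * v)%g}.
Proof.
move=> u v; congr pair; last exact: word_endsM.
rewrite /= extr_profile extl_profile contexts_cat cats0 cats0.
by rewrite /profile map_cat -add_mset.
Qed.
HB.instance Definition _ :=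
  isMultiplicative.Build (plus A) (sdprod ends_action) word_profile word_profileM.

(** Reversing [u] flips each context and reverses their order, which a multiset ignores. *)
Lemma word_profile_star : {morph word_profile : u / star u}.
Proof.
move=> u; congr pair; last exact: word_ends_star.
transitivity (profile (map flip (contexts [::] (val u) [::]))).
  apply/profile_perm/uniq_perm; rewrite ?contexts_uniq //.
    by rewrite map_inj_uniq ?contexts_uniq //; apply/can_inj/flipK.
  move=> [[x a] y]; rewrite mem_contexts.
  rewrite -[(x, a, y)]flipK (mem_map (can_inj (@flipK _ _))) mem_contexts /=.
  by rewrite -(inj_eq (can_inj revK)) revK rev_cat revK rev_cons cat_rcons.
rewrite /star /= /profile push_mset -!map_comp; congr mset.
apply: eq_map => c /=; rewrite /norm_context /= -norm_flip.
by [].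
Qed.

Definition starts (v s : seq A) : bool :=
  (take (size v) s == v) || (take (size v) s == rev v).

(** The left part is read backwards, so the second summand detects an occurrence ending at the
    centre; the sum is symmetric under [flip]. *)
Definition hits v c : nat := starts v (c.1.2 :: c.2) + starts v (c.1.2 :: c.1.1).

Lemma hits_norm v c : hits v (norm c) = hits v c.
Proof.
rewrite /norm; case: ifP => // _; case: (canonP c) => -> //.
exact: addnC.
Qed.

(** Each occurrence counts at its first letter (index [0]) and at its last (index [(size v).-1]),
    also when these coincide. Truncation at [k] hides none of it. *)
Lemma sum_hits v w : 0 < size v <= k ->
  \sum_(c <- map norm_context (contexts [::] w [::])) hits v c =
  (sharpr w v).*2.
Proof.
case/andP=> v_gt0 le_vk.
have readsE (c : context) :
    hits v (norm_context c) = reads 0 v c + reads (size v).-1 v c.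
  have take_k x : take (size v).-1 (take k x) = take (size v).-1 x :> seq A.
    by rewrite -take_min (minn_idPl _) // (leq_trans (leq_pred _)).
  rewrite hits_norm /hits /starts /reads /window subn0 take0 /=.
  case def_v: (size v) v_gt0 => [|l] //= _; rewrite def_v /= in take_k.
  rewrite !take_k subSnn /= take0 cats1 -rev_cons; congr (_ + nat_of_bool _).
  by rewrite orbC (inj_eq (can_inj revK)) (can2_eq revK revK).
rewrite big_map (eq_bigr _ (fun (c : context) _ => readsE c)) big_split /= -addnn.
rewrite {1}(sharprE _ v_gt0) (@sharprE _ (size v).-1) ?prednK // -!sum1_count.
by congr (_ + _); rewrite [RHS]big_mkcond.
Qed.

End Profiles.

Lemma word_profile_inj (A : finType) (k t : nat) (k_gt0 : 0 < k) (u v : plus A) :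
  0 < t -> word_profile t.*2 k_gt0 u = word_profile t.*2 k_gt0 v ->
  thr_equiv k t (val u) (val v).
Proof.
move=> t_gt0 eq_uv.
have eq_pr := congr1 (fun p : sdprod _ => p.1) eq_uv.
have /(congr1 val) eq_ends : word_ends k_gt0 u = word_ends k_gt0 v :=
  congr1 (fun p : sdprod _ => p.2) eq_uv.
have eq_p : take k (val u) = take k (val v) :=
  congr1 (fun p => val p.1) eq_ends.
have eq_s : take k (rev (val u)) = take k (rev (val v)) :=
  congr1 (fun p => val p.2) eq_ends.
have [lt_uk|le_ku] := ltnP (size (val u)) k.
  left; split=> //; move: eq_p; rewrite take_oversize 1?ltnW // => eq_w.
  have [lt_vk|le_kv] := ltnP (size (val v)) k.
    by rewrite eq_w take_oversize // ltnW.
  by move: lt_uk; rewrite eq_w size_takel // ltnn.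
have le_kv : k <= size (val v).
  rewrite leqNgt; apply/negP=> lt_vk; move: (congr1 size eq_p).
  rewrite size_takel // take_oversize 1?ltnW // => eq_k.
  by rewrite -eq_k ltnn in lt_vk.
have take_pred w : take k.-1 w = take k.-1 (take k w).
  by rewrite -take_min (minn_idPl (leq_pred k)).
right; split=> //.
- by rewrite take_pred eq_p -take_pred.
- apply: (can_inj revK); rewrite !rev_drop !subKn ?(leq_trans (leq_pred k)) //.
  by rewrite take_pred eq_s -take_pred.
(* The doubled counts agree up to [t.*2], so the counts agree up to [t]. *)
move=> w sz_w; move: (mset_sum (hits w) eq_pr); rewrite !sum_hits // /thr_eq.
by lia.
Qed.

Lemma lrtt_recognised (A : finType) (L : seq A -> Prop)
    (L_plus : forall w : seq A, L w -> w != [::]) :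
  weakly_lrtt L ->
  exists (S T : finInvolSemigroupType) (act : involutory_action S T),
    [/\ aperiodic S, commutative (@mul S), locally_trivial T,
        locally_hermitian act & recognises (sdprod act) L].
Proof.
case=> k [t [k_gt0 t_gt0 [C LE]]].
exists (counter t.*2 (@mirrorK A k)), (ends A k), (ends_action A k t.*2).
split.
- exact: counter_aperiodic.
- exact: addC.
- exact: ends_locally_trivial.
- exact: ends_action_hermitian.
exists (word_profile t.*2 k_gt0).
(* The accepting set is the image of [L]; the point is that its preimage is no larger. *)
exists (fun p => exists2 u : plus A, L (val u) & word_profile t.*2 k_gt0 u = p).
split=> [|w]; first exact: word_profile_star.
split=> [Lw|[u <- [v /LE[c Cc eq_cv] eq_uv]]].
  by exists (Sub w (L_plus w Lw)) => //; exists (Sub w (L_plus w Lw)).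
apply/LE; exists c => //; apply: thr_equiv_trans eq_cv _.
exact: word_profile_inj eq_uv.
Qed.

(** * Words recognised by a locally hermitian product *)

Section LocallyTrivial.
Variable T : finInvolSemigroupType.
Hypothesis T_lt : locally_trivial T.
Local Open Scope group_scope.
Implicit Types e f q x y : T.

(** Write the [f] of [e * f] as [f * (e * q) * f]; then [e * f * e] collapses to [e]. *)
Lemma idem_sandwich e f q :
  is_idempotent e -> is_idempotent f -> e * q * f = e * f.
Proof. by move=> ee ff; rewrite -{2}(T_lt (e * q) ff) !mulgA (T_lt f ee). Qed.

Lemma idem_mulr x y : is_idempotent x -> is_idempotent (x * y).
Proof. by move=> xx; rewrite /is_idempotent mulgA T_lt. Qed.

(** Some power [e] of [y] is idempotent and [x * e = x]; hence
    [x * x = x * (e * x * e) = x * e = x]. *)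
Lemma fixed_idem x y : x * y = x -> is_idempotent x.
Proof.
move=> xy; pose pw i := iter i (mul y) y.
have x_pw i : x * pw i = x by elim: i => //= i IH; rewrite mulgA xy.
have pwD i j : pw (i + j).+1 = pw i * pw j.
  elim: i => // i IH; rewrite addSn.
  by rewrite -[LHS]/(y * pw (i + j).+1) IH mulgA.
have [i [p [p_gt0 pwE]]] : exists i p, 0 < p /\ pw (i + p)%N = pw i.
  have : ~~ injectiveb (fun i : 'I_(#|T|.+1) => pw i).
    apply/negP=> /injectiveP/leq_card; by rewrite card_ord ltnn.
  case/injectivePn=> i [j ne_ij eq_ij].
  have [lt_ij|lt_ji|/val_inj eq] := ltngtP i j; last by rewrite eq eqxx in ne_ij.
    by exists i, (j - i)%N; rewrite subn_gt0 subnKC // ltnW.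
  by exists j, (i - j)%N; rewrite subn_gt0 subnKC // ltnW.
have period m r : i <= m -> pw (m + p * r)%N = pw m.
  move=> le_im; elim: r => [|r IH]; first by rewrite muln0 addn0.
  rewrite mulnS [(p + _)%N]addnC addnA -IH.
  have: i <= m + p * r by lia.
  move: (m + p * r)%N => m' /subnKC <-; case: (m' - i)%N => [|d].
    by rewrite addn0.
  by rewrite addnAC !addnS !pwD pwE.
(* [pw m] has exponent [m.+1], so this is [y] to the power [p * i.+1], a multiple of the period
   beyond the preperiod. *)
have ee : is_idempotent (pw (p * i.+1).-1).
  rewrite /is_idempotent -pwD -addnS prednK ?muln_gt0 ?p_gt0 //.
  by rewrite period //; nia.
rewrite -{1}(x_pw (p * i.+1).-1) /is_idempotent.
by rewrite -{2}(x_pw (p * i.+1).-1) mulgA -(mulgA x) -(mulgA x) T_lt // !x_pw.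
Qed.

Lemma foldl_mulg x (y : T) s : foldl mul (x * y) s = x * foldl mul y s.
Proof. by elim: s y => //= z s IH y; rewrite -mulgA IH. Qed.

(** Among the more than [#|T|] partial products two agree, so the earlier one is fixed by a right
    factor, hence idempotent; right multiples of an idempotent are idempotent. *)
Lemma foldl_idem x (s : seq T) : #|T| <= size s -> is_idempotent (foldl mul x s).
Proof.
move=> le_T_s; set r := x :: scanl mul x s.
have nth_r m : m <= size s -> nth x r m = foldl mul x (take m s).
  by case: m => [|m] lt_ms; rewrite ?take0 //= nth_scanl.
have : ~~ uniq r.
  apply/negP=> /card_uniqP eq_sz; have := max_card (mem r).
  by rewrite eq_sz /= size_scanl ltnNge le_T_s.
case/(uniqPn x)=> i [j [lt_ij]]; rewrite /= size_scanl ltnS => le_js.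
rewrite !nth_r //; last by rewrite (leq_trans _ le_js) // ltnW.
have -> : take j s = take i s ++ drop i (take j s).
  by rewrite -{1}(cat_take_drop i (take j s)) -take_min (minn_idPl (ltnW lt_ij)).
have : 0 < size (drop i (take j s)) by rewrite size_drop size_takel // subn_gt0.
case: (drop i (take j s)) => // y l _.
rewrite foldl_cat /= foldl_mulg => /esym/fixed_idem idem_i.
rewrite -(cat_take_drop i s) foldl_cat; case: (drop i s) => //= z l'.
by rewrite foldl_mulg; apply: idem_mulr.
Qed.

End LocallyTrivial.

(** * Sums in a commutative aperiodic semigroup *)

Section Aperiodic.
Variable S : involSemigroupType.
Hypothesis S_comm : commutative (@mul S).
Variable n : nat.
Hypothesis n_gt0 : 0 < n.
Hypothesis S_ap : forall a : S, iterop n.+1 mul a a = iterop n mul a a.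

(* [None] stands for the empty sum, as [S] need not have a neutral element. *)
Local Notation oplus := (oAC (@mulgA S) S_comm).

Lemma iterop_oAC m (a : S) :
  iterop m.+1 oplus (Some a) None = Some (iterop m.+1 mul a a).
Proof. by rewrite !iteropS; elim: m => //= m ->. Qed.

Lemma iterop_stable m (a : S) : n <= m -> iterop m mul a a = iterop n mul a a.
Proof.
case: n n_gt0 S_ap => // p _ ap; case: m => // m; rewrite ltnS => /subnK <-.
elim: (m - p) => // d IH; move: IH (ap a); rewrite addSn !iteropS !iterS => ->.
by [].
Qed.

Lemma iterop_thr_eq i j (a : S) : thr_eq n i j ->
  iterop i oplus (Some a) None = iterop j oplus (Some a) None.
Proof.
case/orP=> [/andP[/eqP-> //]|/andP[le_ni le_nj]].
have := leq_trans n_gt0 le_ni; have := leq_trans n_gt0 le_nj.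
case: i j le_ni le_nj => [|i] [|j] // le_ni le_nj _ _.
by rewrite !iterop_oAC !iterop_stable.
Qed.

(** Equal summands are grouped and their multiplicities compared; since [n > 0], both lists have the
    same support. *)
Lemma big_thr_eq (X : eqType) (l l' : seq X) (F : X -> S) :
  (forall d, thr_eq n (count_mem d l) (count_mem d l')) ->
  \big[oplus/None]_(d <- l) Some (F d) = \big[oplus/None]_(d <- l') Some (F d).
Proof.
move=> eq_l; rewrite -[LHS](big_undup_iterop_count _ l).
rewrite -[RHS](big_undup_iterop_count _ l').
rewrite (perm_big (undup l')); last first.
  apply: uniq_perm; rewrite ?undup_uniq // => d.
  rewrite !mem_undup -!has_pred1 !has_count.
  by move: (eq_l d); rewrite /thr_eq; lia.
by apply: eq_bigr => d _; apply: iterop_thr_eq.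
Qed.

End Aperiodic.

Lemma big_omap (S : involSemigroupType) (S_comm : commutative (@mul S))
    (f : S -> S) (X : Type) (l : seq X) (F : X -> S) :
  {morph f : s s' / (s * s')%g} ->
  omap f (\big[oAC (@mulgA S) S_comm/None]_(c <- l) Some (F c)) =
  \big[oAC (@mulgA S) S_comm/None]_(c <- l) Some (f (F c)).
Proof.
move=> fM; apply: (big_morph (omap f)) => //.
by case=> [s|] [s'|] //; rewrite oACE /= fM.
Qed.

Lemma cat3_take_rev (X : Type) m n (w : seq X) : m + n <= size w ->
  w = take m w ++ take (size w - n - m) (drop m w) ++ rev (take n (rev w)).
Proof.
move=> le_w; rewrite take_rev revK -{1}(cat_take_drop m w); congr (_ ++ _).
rewrite -{1}(cat_take_drop (size w - n - m) (drop m w)) drop_drop subnK //.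
by lia.
Qed.

Section ContextSizes.
Variable A : finType.
Implicit Types w x y : seq A.

Lemma contexts_bound x w y c : c \in contexts x w y ->
  (size x <= size c.1.1 < size x + size w) /\
  (size y <= size c.2 < size y + size w).
Proof.
rewrite contextsE => /mapP[[[x' a] y']]; rewrite mem_contexts => /eqP-> -> /=.
rewrite !size_cat size_rev /=; lia.
Qed.

Lemma contexts_size x w y c : c \in contexts x w y ->
  size x <= size c.1.1 /\ size y <= size c.2.
Proof. by case/contexts_bound=> /andP[? _] /andP[? _]. Qed.

End ContextSizes.

(** * The image of a word, letter by letter *)

Section Recognition.
Variables (A : finType) (S T : finInvolSemigroupType).
Variable act : involutory_action S T.
Variable h : {multiplicative plus A -> sdprod act}.
Hypothesis S_comm : commutative (@mul S).
Hypothesis T_lt : locally_trivial T.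
Hypothesis act_lh : locally_hermitian act.
Hypothesis h_star : {morph h : u / star u}.
Local Notation context := (seq A * A * seq A)%type.
Local Notation M := (#|T|.+1).
Implicit Types (a : A) (u v : plus A) (w x y z : seq A) (s : S).

Definition tval u : T := (h u).2.

Lemma tvalM : {morph tval : u v / (u * v)%g}.
Proof. by move=> u v; rewrite /tval gmulfM. Qed.

Lemma tval_star u : tval (star u) = star (tval u).
Proof. by rewrite /tval h_star. Qed.

Definition letter a : plus A := Sub [:: a] isT.

Lemma plusE u a w : val u = a :: w -> u = foldl mul (letter a) (map letter w).
Proof.
move=> uE; apply: val_inj; rewrite uE -cat1s -[[:: a]]/(val (letter a)).
elim: w (letter a) {uE} => [|b w IH] v /=; first by rewrite cats0.
by rewrite -IH /= -catA.
Qed.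

(** A word of length at least [M] is a first letter followed by at least [#|T|] others, as
    [foldl_idem] requires. *)
Lemma tval_idem u : M <= size (val u) -> is_idempotent (tval u).
Proof.
case uE: (val u) => [//|a w]; rewrite ltnS => sz_w.
rewrite (plusE uE).
have -> v l : tval (foldl mul v l) = foldl mul (tval v) (map tval l).
  by elim: l v => //= v' l IH v; rewrite IH tvalM.
by apply: foldl_idem; rewrite ?size_map.
Qed.

(** There is room for disjoint [M]-letter ends [p] and [q], with idempotent values; by
    [idem_sandwich] whatever lies between is invisible. *)
Lemma tval_eq u v :
  M + M <= size (val u) -> M + M <= size (val v) ->
  take M (val u) = take M (val v) ->
  take M (rev (val u)) = take M (rev (val v)) ->
  tval u = tval v.
Proof.
move=> szu szv eq_p eq_q.
have M_le := leq_addl M M.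
have p_ne : take M (val u) != [::].
  by rewrite -size_eq0 size_takel // (leq_trans M_le).
have q_ne : rev (take M (rev (val u))) != [::].
  by rewrite -size_eq0 size_rev size_takel // size_rev (leq_trans M_le).
pose p : plus A := Sub (take M (val u)) p_ne.
pose q : plus A := Sub (rev (take M (rev (val u)))) q_ne.
have p_idem : is_idempotent (tval p).
  by apply: tval_idem; rewrite /= size_takel // (leq_trans M_le).
have q_idem : is_idempotent (tval q).
  by apply: tval_idem; rewrite size_rev size_takel // size_rev (leq_trans M_le).
have H z (v' : plus A) : val v' = val p ++ z ++ val q ->
    tval v' = (tval p * tval q)%g.
  have [->|z_ne] := eqVneq z [::].
    by move=> v'E; rewrite -tvalM; congr tval; apply: val_inj.
  move=> v'E; rewrite -(idem_sandwich T_lt (tval (Sub z z_ne : plus A)) p_idem q_idem).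
  by rewrite -!tvalM; congr tval; apply: val_inj; rewrite v'E /= catA.
rewrite (H _ _ (cat3_take_rev szu)); apply/esym.
by apply: H; rewrite {1}(cat3_take_rev szv) -eq_p -eq_q.
Qed.

(** [T] need not have a unit, so the empty word is made to act as the identity. *)
Definition wlact w s : S := oapp (fun u => lact act (tval u) s) s (insub w).
Definition wract w s : S := oapp (fun u => ract act s (tval u)) s (insub w).

Lemma wlactE u s : wlact (val u) s = lact act (tval u) s.
Proof. by rewrite /wlact valK. Qed.

Lemma wractE u s : wract (val u) s = ract act s (tval u).
Proof. by rewrite /wract valK. Qed.

Lemma wlact0 s : wlact [::] s = s.
Proof. by rewrite /wlact insubF. Qed.

Lemma wract0 s : wract [::] s = s.
Proof. by rewrite /wract insubF. Qed.

Lemma plus_ind (P : seq A -> Prop) :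
  P [::] -> (forall u, P (val u)) -> forall w, P w.
Proof.
move=> P0 Pu w; have [->//|w_ne] := eqVneq w [::].
exact: (Pu (Sub w w_ne : plus A)).
Qed.

Lemma wlact_cat x y s : wlact (x ++ y) s = wlact x (wlact y s).
Proof.
elim/plus_ind: x => [|u]; first by rewrite wlact0.
elim/plus_ind: y => [|v]; first by rewrite cats0 wlact0.
by rewrite -[_ ++ _]/(val (u * v)%g) !wlactE tvalM lactM.
Qed.

Lemma wract_cat x y s : wract (x ++ y) s = wract y (wract x s).
Proof.
elim/plus_ind: x => [|u]; first by rewrite wract0.
elim/plus_ind: y => [|v]; first by rewrite cats0 wract0.
by rewrite -[_ ++ _]/(val (u * v)%g) !wractE tvalM ractM.
Qed.

Lemma wlactC x y s : wract y (wlact x s) = wlact x (wract y s).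
Proof.
elim/plus_ind: x => [|u]; first by rewrite !wlact0.
elim/plus_ind: y => [|v]; first by rewrite !wract0.
by rewrite !(wractE, wlactE) lractC.
Qed.

Lemma wlactM w : {morph wlact w : s s' / (s * s')%g}.
Proof.
elim/plus_ind: w => [|u] s s'; first by rewrite !wlact0.
by rewrite !wlactE lactD.
Qed.

Lemma wractM w : {morph wract w : s s' / (s * s')%g}.
Proof.
elim/plus_ind: w => [|u] s s'; first by rewrite !wract0.
by rewrite !wractE ractD.
Qed.

Lemma star_wract w s : star (wract w s) = wlact (rev w) (star s).
Proof.
elim/plus_ind: w => [|u]; first by rewrite wract0 wlact0.
by rewrite -[rev _]/(val (star u)) wractE wlactE ract_star tval_star.
Qed.

Lemma star_wlact w s : star (wlact w s) = wract (rev w) (star s).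
Proof.
elim/plus_ind: w => [|u]; first by rewrite wract0 wlact0.
by rewrite -[rev _]/(val (star u)) wractE wlactE lact_star tval_star.
Qed.

Lemma word_val w : M + M <= size w -> exists u, w = val u.
Proof.
case: w => // a w _; by exists (Sub (a :: w) isT).
Qed.

Lemma wlact_eq x y s : M + M <= size x -> M + M <= size y ->
  take M x = take M y -> take M (rev x) = take M (rev y) ->
  wlact x s = wlact y s.
Proof.
move=> szx szy; have [u eq_x] := word_val szx; have [v eq_y] := word_val szy.
rewrite {}eq_x {}eq_y in szx szy * => eq_p eq_q.
by rewrite !wlactE (tval_eq szx szy).
Qed.

Lemma wract_eq x y s : M + M <= size x -> M + M <= size y ->
  take M x = take M y -> take M (rev x) = take M (rev y) ->
  wract x s = wract y s.
Proof.
move=> szx szy; have [u eq_x] := word_val szx; have [v eq_y] := word_val szy.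
rewrite {}eq_x {}eq_y in szx szy * => eq_p eq_q.
by rewrite !wractE (tval_eq szx szy).
Qed.

Definition sletter a : S := (h (letter a)).1.

Lemma star_sletter a : star (sletter a) = sletter a.
Proof.
rewrite -[LHS]/(star (h (letter a))).1 -h_star /sletter.
by congr (h _).1; apply: val_inj.
Qed.

Definition term (c : context) : S :=
  wract c.2 (wlact (rev c.1.1) (sletter c.1.2)).

Lemma term_flip c : term (flip c) = star (term c).
Proof.
by rewrite /term star_wract star_wlact star_sletter revK wlactC.
Qed.

Local Notation sum l :=
  (\big[oAC (@mulgA S) S_comm/None]_(c <- l) Some (term c)).

Lemma sum_contexts x w y :
  sum (contexts x w y) =
  omap (fun s => wract y (wlact (rev x) s)) (sum (contexts [::] w [::])).
Proof.
rewrite contextsE big_map big_omap; last by move=> s s'; rewrite wlactM wractM.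
apply: eq_bigr => c _; rewrite /term /= rev_cat wlact_cat wract_cat.
by rewrite (wlactC (rev x)).
Qed.

(** The product formula of [sdprod], unrolled: appending a letter [b] lets it act on the right on
    the sum so far and adds its own term. *)
Lemma fst_sum u : Some (h u).1 = sum (contexts [::] (val u) [::]).
Proof.
case uE: (val u) => [|a w]; first by have := valP u; rewrite uE.
rewrite -uE (plusE uE).
have base : Some (h (letter a)).1 = sum (contexts [::] (val (letter a)) [::]).
  by rewrite big_seq1 /term /= wlact0 wract0.
elim: w (letter a) base {uE} => //= b w IH v vE; apply: IH.
rewrite contexts_cat big_cat /= cats0 (sum_contexts _ _ [:: b]).
rewrite -vE big_seq1 oACE gmulfM /term /= wlact0 wract0 revK.
by rewrite -[[:: b]]/(val (letter b)) wractE wlactE.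
Qed.

Lemma sum_split p z q :
  sum (contexts [::] (p ++ z ++ q) [::]) =
  oAC (@mulgA S) S_comm
    (omap (wract (z ++ q)) (sum (contexts [::] p [::])))
    (oAC (@mulgA S) S_comm
      (sum (contexts (rev p) z q))
      (omap (wlact (p ++ z)) (sum (contexts [::] q [::])))).
Proof.
rewrite !contexts_cat !cats0 !big_cat /=.
congr (oAC _ _ _ _); last congr (oAC _ _ _ _).
  by rewrite sum_contexts; case: (sum _) => //= s; rewrite wlact0.
rewrite sum_contexts; case: (sum _) => //= s.
by rewrite wract0 rev_cat !revK.
Qed.

(** The right contexts are long, so [rev p] may be inserted before [q] unnoticed. Then [p] and
    [rev p], whose values are an idempotent and its star, surround the term, and local hermiticity
    applies. *)
Lemma term_sandwich (p q : seq A) (c : context) :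
  M + M <= size p -> M + M <= size q ->
  M + M <= size c.1.1 -> M + M <= size c.2 ->
  wract q (wlact p (term c)) = wract q (wlact p (term (flip c))).
Proof.
move=> szp szq szx szy.
have M_le l : M + M <= l -> M <= l by apply: leq_trans; apply: leq_addl.
have absorb (d : context) : M + M <= size d.2 ->
    wract q (term d) = wract q (wract (rev p) (term d)).
  move=> szd; rewrite /term -!wract_cat; apply: wract_eq.
  - by rewrite size_cat (leq_trans szd) ?leq_addr.
  - by rewrite !size_cat (leq_trans szd) ?leq_addr.
  - by rewrite !takel_cat // M_le.
  by rewrite !rev_cat -!catA !takel_cat // size_rev M_le.
rewrite (wlactC p q (term c)) (wlactC p q (term (flip c))).
rewrite (absorb c) // (absorb (flip c)) // -!(wlactC p q) -!(wlactC p (rev p)).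
congr (wract q _).
have [u uE] := word_val szp; rewrite uE in szp *.
rewrite -[rev _]/(val (star u)) !wlactE !wractE tval_star term_flip.
by apply: act_lh; apply: tval_idem; apply: M_le.
Qed.

Definition cut (c : context) : context :=
  (take (M + M) c.1.1, c.1.2, take (M + M) c.2).

Definition cut_class (c : context) : context := canon (cut c).

(** Long words act through their [M]-letter ends alone, so cutting a context keeps its term between
    [p] and [q]; [term_sandwich] allows the mirror image. *)
Lemma sum_middle (p z q : seq A) : size p = M + M -> size q = M + M ->
  sum (contexts (rev p) z q) =
  \big[oAC (@mulgA S) S_comm/None]_(d <- map cut_class (contexts (rev p) z q))
     Some (wract q (wlact p (term d))).
Proof.
move=> szp szq; have M_le : M <= M + M by apply: leq_addl.
have [szp' szq'] : M + M <= size p /\ M + M <= size q by rewrite szp szq.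
rewrite big_map [LHS]big_seq [RHS]big_seq; apply: eq_bigr => c c_in.
have [szx szy] := contexts_size c_in.
have -> : wract q (wlact p (term (canon (cut c)))) =
          wract q (wlact p (term (cut c))).
  case: (canonP (cut c)) => -> //; apply/esym/term_sandwich => //=.
  - by rewrite size_takel // -szp -(size_rev p).
  - by rewrite size_takel // -szq.
congr Some; move: c_in szx szy; rewrite size_rev szp szq contextsE.
case/mapP=> -[[x a] y] _ -> /=.
move=> szx szy; rewrite /term /= -wlactC -wlact_cat -wract_cat.
have -> s : wlact (rev (x ++ rev p)) s =
            wlact (p ++ rev (take (M + M) (x ++ rev p))) s.
  (* Both words begin with [p] and end with the same [M] letters next to the centre. *)
  apply: wlact_eq.
  - by rewrite size_rev.
  - by rewrite size_cat szp leq_addr.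
  - by rewrite rev_cat revK !takel_cat // szp.
  rewrite revK rev_cat revK [RHS]takel_cat ?size_takel //.
  by rewrite -take_min (minn_idPl M_le).
apply: wract_eq.
- exact: szy.
- by rewrite size_cat szq leq_addl.
- rewrite [RHS]takel_cat ?size_takel //.
  by rewrite -take_min (minn_idPl M_le).
by rewrite !rev_cat !takel_cat // size_rev szq.
Qed.

(** This is [sharprE] with the centre at index [M + M]: a letter of [p] or [q] has too few letters
    on its outer side to read the word. Classes are canonical with sides of length [M + M], which
    gives [0] for any other triple. *)
Lemma count_middle (p z q : seq A) (x0 y0 : seq A) (a0 : A) :
  size p = M + M -> size q = M + M ->
  count_mem (x0, a0, y0) (map cut_class (contexts (rev p) z q)) =
  if [&& canon (x0, a0, y0) == (x0, a0, y0), size x0 == M + M & size y0 == M + M]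
  then sharpr (p ++ z ++ q) (rev x0 ++ a0 :: y0) else 0.
Proof.
move=> szp szq; set d := (x0, a0, y0).
have cut_size (c : context) : c \in contexts (rev p) z q ->
    size (cut c).1.1 = M + M /\ size (cut c).2 = M + M.
  by case/contexts_size; rewrite size_rev szp szq => szx szy; rewrite !size_takel.
case: ifP => [/and3P[/eqP dE /eqP szx0 /eqP szy0]|not_d]; last first.
  apply/count_memPn/mapP => -[c c_in dE]; case/and3P: not_d.
  have [szx szy] := cut_size c c_in.
  rewrite -/d dE /cut_class canon_idem eqxx -[x0]/(d.1.1) -[y0]/(d.2) dE /=.
  rewrite /cut_class.
  by case: (canonP (cut c)) => ->; rewrite /= szx szy eqxx.
have lt_Nv : M + M < size (rev x0 ++ a0 :: y0).
  by rewrite size_cat size_rev szx0 /=; lia.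
rewrite (sharprE _ lt_Nv) !contexts_cat !cats0 !count_cat.
have szv : size (rev x0 ++ a0 :: y0) - (M + M) = (M + M).+1.
  by rewrite size_cat size_rev szx0 /= szy0 addKn.
rewrite [X in X + _](_ : _ = 0); last first.
  apply/eqP; rewrite -leqn0 leqNgt -has_count; apply/hasPn => c.
  case/contexts_bound=> /andP[_ ltx] _; apply/negP=> /(reads_size lt_Nv).
  by case/andP; rewrite leqNgt -szp ltx.
rewrite [X in _ + (_ + X)](_ : _ = 0); last first.
  apply/eqP; rewrite -leqn0 leqNgt -has_count; apply/hasPn => c.
  case/contexts_bound=> _ /andP[_ lty]; apply/negP=> /(reads_size lt_Nv).
  by case/andP=> _; rewrite szv ltnS leqNgt -szq lty.
rewrite add0n addn0 count_map; apply: eq_in_count => c c_in /=.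
rewrite -[in LHS]dE eq_canon /reads /window szv /=.
have [szx szy] := cut_size c c_in.
rewrite rev_cat rev_cons cat_rcons revK.
rewrite !eqseq_cat ?size_rev ?szx ?szx0 ?szy0 // !eqseq_cons.
rewrite !(inj_eq (can_inj revK)) /d /flip -!pair_eqE /= -!pair_eqE /=.
by rewrite !andbA.
Qed.

Variable n : nat.
Hypothesis n_gt0 : 0 < n.
Hypothesis S_ap : forall s, iterop n.+1 mul s s = iterop n mul s s.

(** The length [4M+1] is that of a window with [2M] letters on each side of its centre. Common ends
    of length [4M] settle the letters near the ends; window counts settle the middle. *)
Lemma thr_equiv_image u v :
  thr_equiv (M + M + (M + M)).+1 n (val u) (val v) -> h u = h v.
Proof.
case=> [[_ /val_inj->]//|[szu szv eq_p eq_q eq_n]].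
rewrite /= in eq_p eq_q.
have le_u : M + M + (M + M) <= size (val u) by apply: ltnW.
have le_v : M + M + (M + M) <= size (val v) by apply: ltnW.
have {}eq_q : take (M + M + (M + M)) (rev (val u)) =
              take (M + M + (M + M)) (rev (val v)).
  by rewrite !take_rev eq_q.
have take_eq m (x y : seq A) : m <= M + M + (M + M) ->
    take (M + M + (M + M)) x = take (M + M + (M + M)) y -> take m x = take m y.
  by move=> le_m eq_xy; rewrite -(minn_idPl le_m) !take_min eq_xy.
have eq_tval : tval u = tval v.
  by apply: tval_eq; rewrite ?(leq_trans _ le_u) ?(leq_trans _ le_v) ?leq_addr //;
    apply: take_eq => //; rewrite -addnA leq_addr.
rewrite [h u]surjective_pairing [h v]surjective_pairing.
congr pair; last exact: eq_tval.
apply: Some_inj; rewrite !fst_sum.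
have uE := cat3_take_rev le_u; have vE := cat3_take_rev le_v.
move: (take _ (drop _ (val u))) (take _ (drop _ (val v))) uE vE => zu zv.
have szp : size (take (M + M) (val u)) = M + M.
  by rewrite size_takel // (leq_trans (leq_addr _ _) le_u).
have szq : size (rev (take (M + M) (rev (val u)))) = M + M.
  by rewrite size_rev size_takel // size_rev (leq_trans (leq_addr _ _) le_u).
rewrite -(take_eq _ _ _ (leq_addr _ _) eq_p) -(take_eq _ _ _ (leq_addr _ _) eq_q).
move: (take _ (val u)) (rev (take _ _)) szp szq => p q szp szq uE vE.
(* [p] takes [2M] letters, so agreement on [3M] gives the [M] letters that follow it; likewise
   before [q]. *)
have le_M4 : M + (M + M) <= M + M + (M + M) by lia.
rewrite uE vE !sum_split.
have -> : omap (wract (zu ++ q)) (sum (contexts [::] p [::])) =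
          omap (wract (zv ++ q)) (sum (contexts [::] p [::])).
  case: (sum _) => //= s; congr Some; apply: wract_eq.
  - by rewrite size_cat szq leq_addl.
  - by rewrite size_cat szq leq_addl.
  - have := take_eq _ _ _ le_M4 eq_p; rewrite uE vE => /(congr1 (drop (M + M))).
    by rewrite -!take_drop !drop_size_cat.
  by rewrite !rev_cat !takel_cat // size_rev szq leq_addl.
have -> : omap (wlact (p ++ zu)) (sum (contexts [::] q [::])) =
          omap (wlact (p ++ zv)) (sum (contexts [::] q [::])).
  case: (sum _) => //= s; congr Some; apply: wlact_eq.
  - by rewrite size_cat szp leq_addr.
  - by rewrite size_cat szp leq_addr.
  - by rewrite !takel_cat // szp leq_addl.
  have := take_eq _ _ _ le_M4 eq_q; rewrite uE vE => /(congr1 (drop (M + M))).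
  by rewrite -!take_drop !catA !(rev_cat _ q) !drop_size_cat // size_rev.
congr (oAC _ _ _ _); last congr (oAC _ _ _ _).
rewrite !sum_middle //; apply: (big_thr_eq S_comm n_gt0 S_ap
  (fun d => wract q (wlact p (term d)))) => -[[x0 a0] y0].
rewrite !count_middle //; case: ifP => [/and3P[_ /eqP szx /eqP szy]|_]; last first.
  exact: thr_eq_refl.
rewrite -uE -vE; apply: eq_n.
by rewrite size_cat size_rev /= szx szy addnS leqnn.
Qed.

End Recognition.

Lemma recognised_lrtt (A : finType) (L : seq A -> Prop)
    (S T : finInvolSemigroupType) (act : involutory_action S T) :
  aperiodic S -> commutative (@mul S) -> locally_trivial T ->
  locally_hermitian act -> recognises (sdprod act) L -> weakly_lrtt L.
Proof.
case=> n n_gt0 S_ap S_comm T_lt act_lh [h [P [h_star LE]]].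
set m := #|T|.+1; exists (m + m + (m + m)).+1, n; split=> //.
(* [L] serves as its own set of representatives; it remains to see that it is saturated. *)
exists L => w; split=> [Lw|[u Lu eq_uw]].
  by exists w => //; apply: thr_equiv_refl.
have [u' uE Pu] := (LE u).1 Lu.
have w_ne : w != [::].
  by case: w eq_uw => [|//] [[_ u0]|[]] //; have := valP u'; rewrite uE u0.
apply/LE; exists (Sub w w_ne : plus A) => //.
suff <- : h u' = h (Sub w w_ne : plus A) by [].
by apply: (thr_equiv_image S_comm T_lt act_lh h_star n_gt0 S_ap); rewrite uE.
Qed.

Theorem theorem2 (A : finType) (L : seq A -> Prop)
    (L_plus : forall w : seq A, L w -> w != [::]) :
  weakly_lrtt L <->
  exists (S T : finInvolSemigroupType) (act : involutory_action S T),
    [/\ aperiodic S, commutative (@mul S), locally_trivial T,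
        locally_hermitian act & recognises (sdprod act) L].
Proof.
split; first exact: lrtt_recognised.
by case=> S [T [act [S_ap S_comm T_lt act_lh]]]; apply: recognised_lrtt.
Qed.
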